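(* Let $G=(V,E,w)$ be a weighted graph, $k\ge 1$, and $f$ a positive integer. Let $H$ be the output of the Light Fault-Tolerant Greedy Spanner Algorithm on input $(G,k,f)$. Then $H$ is an $f$-EFT $k$-spanner of $G$.
   Context: An edge-subgraph $H$ of $G$ is an $f$-EFT $k$-spanner of $G$ if $\mathrm{dist}_{H\setminus F}(u,v)\le k\cdot \mathrm{dist}_{G\setminus F}(u,v)$ for all $u,v\in V$ and all $F\subseteq E$ with $|F|\le f$. A subgraph $Q\subseteq G$ is an $f'$-EFT connectivity preserver if for every $F\subseteq E$ with $|F|\le f'$, the connected components of $Q\setminus F$ equal those of $G\setminus F$. Light Fault-Tolerant Greedy Spanner Algorithm on input $(G,k,f)$: let $Q$ be a minimum-weight $2f$-EFT connectivity preserver of $G$; initialize $H\leftarrow Q$; then for each edge $(u,v)\in E(G)\setminus Q$ in order of nondecreasing weight, add $(u,v)$ to $H$ if and only if there exists $F\subseteq E(H)$ with $|F|\le f$ such that $\mathrm{dist}_{H\setminus F}(u,v)>k\cdot w(u,v)$ (with $H$ the current graph); return $H$. *)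

(* Defs.v *)
From HB Require Import structures.
From mathcomp Require Import all_boot all_order all_algebra.
From mathcomp Require Import boolp classical_sets reals ereal.

Set Implicit Arguments.
Unset Strict Implicit.
Unset Printing Implicit Defensive.

Import Order.TTheory GRing.Theory Num.Theory.

Local Open Scope ring_scope.

(* Finite simple undirected graph: an edge is a two-element set of vertices.
   The values of [weight] off [edges] are irrelevant. *)
Record wgraph (R : realType) (V : finType) := WGraph {
  edges : {set {set V}};
  weight : {set V} -> R;
  edges_card2 : forall e, e \in edges -> #|e| = 2%N;
  weight_ge0 : forall e, e \in edges -> 0 <= weight e }.

(* The edge-subgraphs of G (all of them on the full vertex set V) are
   represented by the subsets of [edges G]; in particular the graph D \ F is
   the set D :\: F. *)
Section Subgraphs.
Variables (R : realType) (V : finType).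
Implicit Types (G : wgraph R V) (D F H Q : {set {set V}}) (u v : V).

Definition adj D : rel V := fun x y => [set x; y]%SET \in D.

Definition components D : {set {set V}} :=
  equivalence_partition (connect (adj D)) [set: V]%SET.

Definition path_length G u (p : seq V) : R :=
  \sum_(e <- pairmap (fun x y => [set x; y]%SET) u p) weight G e.

(* Equal to +oo when D has no path from u to v. Repeated vertices are allowed
   in p; for weights >= 0 they do not change the infimum. *)
Definition dist G D u v : \bar R :=
  ereal_inf [set (path_length G u p)%:E | p in
    [set p : seq V | path (adj D) u p /\ last u p = v]]%classic.

Definition eft_spanner G (k : R) (f : nat) H : Prop :=
  H \subset edges G /\
  forall u v F, F \subset edges G -> (#|F| <= f)%N ->
    (dist G (H :\: F) u v <= k%:E * dist G (edges G :\: F) u v)%E.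

Definition eft_connectivity_preserver G (f : nat) Q : Prop :=
  Q \subset edges G /\
  forall F, F \subset edges G -> (#|F| <= f)%N ->
    components (Q :\: F) = components (edges G :\: F).

Definition total_weight G D : R := \sum_(e in D) weight G e.

Definition min_weight_eft_connectivity_preserver G (f : nat) Q : Prop :=
  eft_connectivity_preserver G f Q /\
  forall Q', eft_connectivity_preserver G f Q' ->
    total_weight G Q <= total_weight G Q'.

(* An edge e determines its endpoints u, v only up to order, which is
   immaterial since [dist] is symmetric. *)
Definition greedy_test G (k : R) (f : nat) H (e : {set V}) : bool :=
  [exists F : {set {set V}}, [&& F \subset H, (#|F| <= f)%N &
    [exists u, exists v, (e == [set u; v]%SET) &&
      ((k * weight G e)%:E < dist G (H :\: F) u v)%E]]].

Definition greedy_step G (k : R) (f : nat) H (e : {set V}) : {set {set V}} :=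
  if greedy_test G k f H e then (e |: H)%SET else H.

(* The algorithm leaves open the choice of Q and the order among edges of equal
   weight, hence "H is an output" is a relation. *)
Definition light_ft_greedy_output G (k : R) (f : nat) H : Prop :=
  exists Q (s : seq {set V}),
    [/\ min_weight_eft_connectivity_preserver G (2 * f)%N Q,
        perm_eq s (enum (edges G :\: Q)),
        sorted (fun e1 e2 => weight G e1 <= weight G e2) s
      & H = foldl (greedy_step G k f) Q s].

End Subgraphs.

(* Main.v *)
Require Import Defs.
From HB Require Import structures.
From mathcomp Require Import all_boot all_order all_algebra.
From mathcomp Require Import boolp classical_sets reals ereal.

Set Implicit Arguments.
Unset Strict Implicit.
Unset Printing Implicit Defensive.

Import Order.TTheory GRing.Theory Num.Theory.

Local Open Scope ring_scope.

(** Fix a fault set [F] and an edge [e = {x, y}] of [G \ F]. If [e] is in [H],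
    it has stretch [1 <= k] in [H \ F]. Otherwise [e] was rejected against some
    intermediate graph [H'] included in [H]; the failure of the test on the
    fault set [F :&: H'] says that [x] and [y] are at distance at most [k * w e]
    in [H' \ F], hence in [H \ F]. Replacing each edge of a path of [G \ F] in
    this way shows that [H \ F] stretches all distances by at most [k]. *)

Section Distance.
Variables (R : realType) (V : finType) (G : wgraph R V).
Implicit Types (D F H : {set {set V}}) (u v x y : V) (e : {set V}).

Lemma path_length_cons u v p :
  path_length G u (v :: p) = weight G [set u; v]%SET + path_length G v p.
Proof. by rewrite /path_length /= big_cons. Qed.

Lemma path_length_cat u p q :
  path_length G u (p ++ q) = path_length G u p + path_length G (last u p) q.
Proof. by rewrite /path_length pairmap_cat big_cat. Qed.

Lemma dist_le_path_length D u p : path (adj D) u p ->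
  (dist G D u (last u p) <= (path_length G u p)%:E)%E.
Proof. by move=> Dp; apply: ereal_inf_lbound; exists p. Qed.

Lemma dist_le_weight D x y : adj D x y ->
  (dist G D x y <= (weight G [set x; y]%SET)%:E)%E.
Proof.
move=> Dxy; have /= := @dist_le_path_length D x [:: y].
by rewrite Dxy path_length_cons /path_length /= big_nil addr0; apply.
Qed.

Lemma subset_dist D D' u v : D \subset D' -> (dist G D' u v <= dist G D u v)%E.
Proof.
move=> /fintype.subsetP sDD'; apply: ereal_inf_le_tmp => _ [p [Dp pv] <-].
by exists p => //; split=> //; apply: sub_path Dp => x y /sDD'.
Qed.

(* Stated with real upper bounds because weights off [edges G] are arbitrary,
   so that [dist] may take the value -oo. *)
Lemma dist_triangle_le D u v x (a b : R) :
  (dist G D u v <= a%:E)%E -> (dist G D v x <= b%:E)%E ->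
  (dist G D u x <= (a + b)%:E)%E.
Proof.
move=> le_a le_b; apply/lee_addgt0Pr => eps eps_gt0.
(* The infima need not be attained, so each bound gets a path exceeding it by less than [eps / 2],
   and the two paths are concatenated. *)
have eps2_gt0 : 0 < eps / 2 by rewrite divr_gt0.
have lt_fin (c : R) : (c%:E < (c + eps / 2)%:E)%E by rewrite lte_fin ltrDl.
have /ereal_inf_lt[_ [p [Dp pv] <-]] := le_lt_trans le_a (lt_fin a).
have /ereal_inf_lt[_ [q [Dq qx] <-]] := le_lt_trans le_b (lt_fin b).
rewrite !lte_fin => lt_q lt_p.
have -> : x = last u (p ++ q) by rewrite last_cat pv.
apply: (le_trans (dist_le_path_length _)).
  by rewrite cat_path Dp pv.
rewrite path_length_cat pv -EFinD lee_fin [eps]splitr addrACA.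
by rewrite lerD // ltW.
Qed.

Lemma dist_le_stretch (k : R) D D' u p :
  (forall x y, adj D x y ->
     (dist G D' x y <= (k * weight G [set x; y]%SET)%:E)%E) ->
  path (adj D) u p ->
  (dist G D' u (last u p) <= (k * path_length G u p)%:E)%E.
Proof.
move=> stretch; elim: p u => [|v p IHp] u /=.
  move=> _; rewrite [path_length _ _ _]big_nil mulr0.
  have := @dist_le_path_length D' u [::] isT.
  by rewrite [path_length _ _ _]big_nil.
case/andP=> Duv Dp; rewrite path_length_cons mulrDr.
exact: dist_triangle_le (stretch _ _ Duv) (IHp _ Dp).
Qed.

Lemma dist_stretch (k : R) D D' u v : 0 < k ->
  (forall x y, adj D x y ->
     (dist G D' x y <= (k * weight G [set x; y]%SET)%:E)%E) ->
  (dist G D' u v <= k%:E * dist G D u v)%E.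
Proof.
(* With [k] moved to the left, it remains to bound each path length in [D] from below. This also
   covers the case where [D] has no path and the infimum is [+oo]. *)
move=> k_gt0 stretch; rewrite -lee_pdivrMl //.
apply/ereal_infP => _ [p [Dp <-] <-].
by rewrite lee_pdivrMl // -EFinM; apply: dist_le_stretch Dp.
Qed.

End Distance.

Section Greedy.
Variables (R : realType) (V : finType) (G : wgraph R V) (k : R) (f : nat).
Implicit Types (D F H : {set {set V}}) (x y : V) (e : {set V}).

Lemma greedy_testPn H F x y : ~~ greedy_test G k f H [set x; y]%SET ->
  (#|F| <= f)%N ->
  (dist G (H :\: F) x y <= (k * weight G [set x; y]%SET)%:E)%E.
Proof.
move=> rejected le_Ff; rewrite leNgt; apply: contra rejected => far.
(* The test only ranges over fault sets inside [H], whereas [F] is arbitrary; intersecting with [H]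
   does not change [H :\: F]. *)
apply/existsP; exists (H :&: F)%SET; rewrite finset.subsetIl /=.
rewrite (leq_trans (subset_leq_card (finset.subsetIr H F)) le_Ff) /=.
apply/existsP; exists x; apply/existsP; exists y; rewrite eqxx /=.
by rewrite finset.setDIr finset.setDv finset.set0U.
Qed.

Lemma subset_greedy_step H e : H \subset greedy_step G k f H e.
Proof. by rewrite /greedy_step; case: ifP => // _; apply: finset.subsetUr. Qed.

Lemma subset_foldl_greedy H s : H \subset foldl (greedy_step G k f) H s.
Proof.
elim: s H => [|e s IHs] H //=.
exact: fintype.subset_trans (subset_greedy_step H e) (IHs _).
Qed.

Lemma foldl_greedy_subset D H s : H \subset D -> {subset s <= D} ->
  foldl (greedy_step G k f) H s \subset D.
Proof.
elim: s H => [|e s IHs] H //= sHD sD; apply: IHs => [|e' s_e']; last first.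
  by rewrite sD // inE s_e' orbT.
rewrite /greedy_step; case: ifP => // _.
by rewrite finset.subUset finset.sub1set sHD sD // mem_head.
Qed.

(** The witness is the graph at the moment [e] is first processed: had the test succeeded, [e] would
    have been added then, and edges are never removed. *)
Lemma foldl_greedy_rejected H s e : e \in s ->
  e \notin foldl (greedy_step G k f) H s ->
  exists2 H' : {set {set V}}, H' \subset foldl (greedy_step G k f) H s
    & ~~ greedy_test G k f H' e.
Proof.
elim: s H => [|e' s IHs] H //=; rewrite inE => /predU1P[<-|]; last exact: IHs.
move=> notH; exists H.
  apply: fintype.subset_trans (subset_greedy_step H e) _.
  exact: subset_foldl_greedy.
apply: contra notH => test_e.
apply: (fintype.subsetP (subset_foldl_greedy _ s)).
by rewrite /greedy_step test_e finset.setU11.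
Qed.

End Greedy.

Theorem theorem3p5 (R : realType) (V : finType) (G : wgraph R V) (k : R)
    (f : nat) (H : {set {set V}}) (hk : 1 <= k) (hf : (0 < f)%N)
    (hH : light_ft_greedy_output G k f H) :
  eft_spanner G k f H.
Proof.
case: hH => Q [s [[[sQG _] _] /perm_mem s_mem _ ->]].
set H' := foldl _ _ _; split.
  apply: foldl_greedy_subset => // e.
  by rewrite s_mem mem_enum inE => /andP[].
move=> u v F _ le_Ff; apply: dist_stretch => [|x y].
  exact: lt_le_trans hk.
rewrite /adj inE => /andP[notF Gxy].
have [Hxy|notH] := boolP ([set x; y]%SET \in H').
  apply: (le_trans (dist_le_weight _ _)); first by rewrite /adj inE notF.
  (* As weights in [G] are nonnegative, [1 <= k] makes the weight of the edge at most [k] times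
     itself. *)
  by rewrite lee_fin ler_peMl // weight_ge0.
(* The output contains [Q], so an edge of [G] missing from it lies outside [Q] and was therefore
   processed. *)
have s_xy : [set x; y]%SET \in s.
  rewrite s_mem mem_enum inE Gxy andbT.
  by apply: contra notH; apply/fintype.subsetP/subset_foldl_greedy.
have [H0 sH0 /greedy_testPn near] := foldl_greedy_rejected s_xy notH.
by apply: le_trans (near F le_Ff); apply/subset_dist/finset.setSD.
Qed.
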